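(* Let $\gamma\ge0$. (i) For $i=1,2$, let $F_i$ be a distribution supported on $[0,\infty)$ satisfying $$\liminf_{x\to\infty}\frac{\overline{F_i}(x-t)}{\overline{F_i}(x)}\ge e^{\gamma t}\quad\text{for all } t>0 .$$ Assume that $F_2\in\mathcal{OL}$ and $\lim_{x\to\infty}\overline{F_1}(x)\,C^*(F_2,x)=0$. Then $$\liminf_{x\to\infty}\frac{\overline{F_1*F_2}(x-t)}{\overline{F_1*F_2}(x)}\ge e^{\gamma t}\quad\text{for all } t>0 .$$ (ii) Further, if the assumptions of (i) hold with $F_1=F$ and $F_2=F^{*k_0}\in\mathcal{OL}$ for some distribution $F$ and some integer $k_0\ge1$, then $$\liminf_{x\to\infty}\frac{\overline{F^{*k}}(x-t)}{\overline{F^{*k}}(x)}\ge e^{\gamma t}\quad\text{for all } t>0$$ holds for all $k\ge k_0$. In particular, if $k_0=1$, then it holds for all $k\ge1$.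
   Context: All distributions are supported on $[0,\infty)$. $\overline V=1-V$; $V^{*k}$ is the $k$-fold convolution of $V$ with itself. A distribution $V$ belongs to $\mathcal{OL}$ if for every $t>0$, $C^*(V,t)=\limsup_{x\to\infty}\overline V(x-t)/\overline V(x)<\infty$. Any condition on a ratio as $x\to\infty$ presupposes that its denominator is positive for all sufficiently large $x$. *)

(* Defs.v *)
From HB Require Import structures.
From mathcomp Require Import all_boot all_order all_algebra.
From mathcomp Require Import all_classical all_reals all_analysis.

Set Implicit Arguments.
Unset Strict Implicit.
Unset Printing Implicit Defensive.

Import Order.TTheory GRing.Theory Num.Theory.
Import numFieldNormedType.Exports.

Local Open Scope classical_set_scope.
Local Open Scope ring_scope.

Notation distr R := (probability (measurableTypeR R) R).

Section convolution.
Context {R : realType}.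
Let T : measurableType _ := measurableTypeR R.

Definition addp (z : T * T) : T := z.1 + z.2 :> R.

Let measurable_addp : measurable_fun [set: T * T] addp.
Proof.
apply: measurable_realfun.measurable_funD; [exact: measurable_fst|].
exact: measurable_snd.
Qed.

HB.instance Definition _ :=
  isMeasurableFun.Build _ _ (T * T)%type T addp measurable_addp.

(* the law of X + Y for independent X ~ V and Y ~ W *)
Definition convolve (V W : distr R) : distr R := distribution (V \x W)%E addp.

Fixpoint convolve_pow (V : distr R) (k : nat) : distr R :=
  if k is k'.+1 then convolve V (convolve_pow V k') else \d_(0 : T).

End convolution.

Section tails.
Context {R : realType}.
Implicit Types (V : distr R) (x t gamma : R).

Definition supported_nonneg V : Prop := V `]-oo, (0 : R)[%classic = 0%E.

Definition tail V x : R := 1 - fine (V `]-oo, x]%classic).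

(* needed explicitly because division by 0 is total: it is the presupposition
   behind every condition on a ratio with denominator tail V x as x --> +oo *)
Definition tail_pos V : Prop := \forall x \near +oo, 0 < tail V x.

Definition tail_ratio V t x : \bar R := (tail V (x - t) / tail V x)%:E.

Definition Cstar V t : \bar R := limf_esup (tail_ratio V t) +oo%R.

Definition OL V : Prop :=
  tail_pos V /\ forall t, 0 < t -> (Cstar V t < +oo)%E.

Definition liminf_ratio_ge gamma V : Prop :=
  tail_pos V /\
  forall t, 0 < t -> ((expR (gamma * t))%:E <= limf_einf (tail_ratio V t) +oo%R)%E.

End tails.

(* Main.v *)
Require Import Defs.
From HB Require Import structures.
From mathcomp Require Import all_boot all_order all_algebra.
From mathcomp Require Import all_classical all_reals all_analysis.
From mathcomp Require Import ring lra.

Import Order.TTheory GRing.Theory Num.Theory.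
Import numFieldNormedType.Exports.

Local Open Scope classical_set_scope.
Local Open Scope ring_scope.

(** Let X ~ F1 and Y ~ F2 be independent. On the event X + Y > x either X <= a,
    or Y <= x - a - t, or both X > a and Y > x - a - t. On the first event, given
    X, the sum exceeds x when Y exceeds a level at least x - a, and moving that
    level down by t multiplies the probability by at least about e^(gamma t);
    on the second event the same holds for X, whose level is at least a + t.
    After the shift from x to x - t the first two events are still disjoint, so
    the probability of their union grows by that factor
    ([convolve_tail_split]). The third event has probability
    tail F1 a * tail F2 (x - a - t), which is asymptotically at most
    tail F1 a * C*(F2, a) * C*(F2, t) * tail F2 x. The limit hypothesis makes the
    coefficient small when a is large ([tail_Cstar_small]), and
    tail F2 x <= tail (F1 * F2) x because X >= 0. This gives
    [liminf_ratio_ge_convolve].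

    For the powers one applies this inductively to F and F^{*k}, so the
    hypotheses on F^{*k} must pass to F^{*(k+1)}. This follows from
      C*(F^{*(k+1)}, t) <= 2 C*(F^{*k}, t)    (k >= 1),
    which is [Cstar_convolve_le]. To see it let S be an independent sum of k
    copies and cut at half the level: if X + S > 2b then X <= b, or S <= b, or
    both X > b and S > b. The second event is the dangerous one, because F itself
    is not assumed to be in OL; but S contains a copy X' of X, and exchanging X
    with X' maps this event into the first one ([product_convolve_swap_le]). In
    the first and third events the large variable is S, so raising the level by t
    costs a factor of about C*(F^{*k}, t), and the raised events are disjoint
    parts of the event X + S > 2b + t ([convolve_tail_double]). *)

(** * Limits superior and inferior along a filter *)

Lemma limf_esup_lt_near {T : choiceType} {X : filteredType T} {R : realType}
    (f : X -> \bar R) (F : set_system X) (l : \bar R) :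
  Filter F -> (limf_esup f F < l)%E -> \forall x \near F, (f x < l)%E.
Proof.
move=> FF; rewrite limf_esupE => /ereal_inf_lt[_ [A FA <-] supA].
apply: filterS FA => x Ax; apply: le_lt_trans supA.
by apply: ereal_sup_ubound; exists x.
Qed.

Lemma near_limf_esup_le {T : choiceType} {X : filteredType T} {R : realType}
    (f : X -> \bar R) (F : set_system X) (l : \bar R) :
  (\forall x \near F, (f x <= l)%E) -> (limf_esup f F <= l)%E.
Proof.
move=> Ffl; rewrite limf_esupE.
apply: (@le_trans _ _ (ereal_sup (f @` [set x | (f x <= l)%E]))).
  by apply: ereal_inf_lbound; exists [set x | (f x <= l)%E].
by apply: ge_ereal_sup => _ [x fxl <-].
Qed.

Lemma lt_limf_einf_near {T : choiceType} {X : filteredType T} {R : realType}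
    (f : X -> \bar R) (F : set_system X) (l : \bar R) :
  Filter F -> (l < limf_einf f F)%E -> \forall x \near F, (l < f x)%E.
Proof.
move=> FF; rewrite /limf_einf lteNr => /limf_esup_lt_near.
by apply: filterS => x; rewrite lteN2.
Qed.

Lemma near_le_limf_einf {T : choiceType} {X : filteredType T} {R : realType}
    (f : X -> \bar R) (F : set_system X) (l : \bar R) :
  Filter F -> (\forall x \near F, (l <= f x)%E) -> (l <= limf_einf f F)%E.
Proof.
move=> FF Flf; rewrite /limf_einf leeNr; apply: near_limf_esup_le.
by apply: filterS Flf => x; rewrite leeN2.
Qed.

(** * Comparing product measures by sections *)

Section product_sections.
Context {d1 d2} {T1 : measurableType d1} {T2 : measurableType d2} {R : realType}.
Variables (m1 : {sigma_finite_measure set T1 -> \bar R}).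
Variables (m2 : {sigma_finite_measure set T2 -> \bar R}).
Implicit Types A B : set (T1 * T2).

Lemma le_product_xsection (m : R) A B : 0 <= m ->
  measurable A -> measurable B ->
  (forall x : T1,
    (m2 [set y | A (x, y)] <= m%:E * m2 [set y | B (x, y)])%E) ->
  ((m1 \x m2) A <= m%:E * (m1 \x m2) B)%E.
Proof.
move=> m0 mA mB AB; rewrite -ge0_integralZl//; first last.
- exact: measurable_fun_xsection.
apply: ge0_le_integral => //.
- exact: measurable_fun_xsection.
- by apply: measurable_funeM; exact: measurable_fun_xsection.
- by move=> x _; rewrite /= !xsectionE; exact: AB.
Qed.

Lemma product_measure12E A : measurable A ->
  (m1 \x m2)%E A = (m1 \x^ m2)%E A.
Proof.
move=> mA; rewrite [RHS](_ : _ = (m1 \x^ m2 : {measure set _ -> \bar R})%E A)//.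
by apply: product_measure_unique => // *; rewrite /= product_measure2E.
Qed.

Lemma le_product_ysection (m : R) A B : 0 <= m ->
  measurable A -> measurable B ->
  (forall y : T2,
    (m1 [set x | A (x, y)] <= m%:E * m1 [set x | B (x, y)])%E) ->
  ((m1 \x m2) A <= m%:E * (m1 \x m2) B)%E.
Proof.
move=> m0 mA mB AB; rewrite !product_measure12E// -ge0_integralZl//; first last.
- exact: measurable_fun_ysection.
apply: ge0_le_integral => //.
- exact: measurable_fun_ysection.
- by apply: measurable_funeM; exact: measurable_fun_ysection.
- by move=> x _; rewrite /= !ysectionE; exact: AB.
Qed.

End product_sections.

(** * Tails and the asymptotic classes *)

Section tails.
Set Implicit Arguments.
Unset Strict Implicit.
Context {R : realType}.
Notation T := (measurableTypeR R).
Implicit Types (U V W M : distr R) (x t a b s m gamma : R).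

Lemma tailE V x : (tail V x)%:E = V `]x, +oo[%classic.
Proof.
rewrite /tail EFinB fineK ?fin_num_measure//.
by rewrite -probability_setC// setCitvl.
Qed.

Lemma tail_ge0 V x : 0 <= tail V x.
Proof. by rewrite -lee_fin tailE measure_ge0. Qed.

Lemma tail_le1 V x : tail V x <= 1.
Proof. by rewrite -lee_fin tailE probability_le1. Qed.

(** Removes the quotient and the lower limit: an eventual linear inequality
    between tails is what can be integrated against another distribution. *)
Lemma liminf_ratio_geP gamma V : liminf_ratio_ge gamma V <-> tail_pos V /\
  forall t c, 0 < t -> c < expR (gamma * t) ->
    \forall x \near +oo, c * tail V x <= tail V (x - t).
Proof.
split=> -[V0 VP]; split=> //.
  move=> t c t0 ct; have := VP _ t0.
  rewrite -(@lte_fin R) in ct => /(lt_le_trans ct)/lt_limf_einf_near cV.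
  near=> x; rewrite -ler_pdivlMr; last by near: x.
  by rewrite ltW// -lte_fin; near: x; exact: cV.
move=> t t0; apply/lee_subgt0Pr => e e0; apply: near_le_limf_einf.
have := VP t (expR (gamma * t) - e) t0; rewrite ltrBlDr ltrDl => /(_ e0) cV.
near=> x; rewrite -EFinB lee_fin ler_pdivlMr; last by near: x.
by near: x.
Unshelve. all: end_near. Qed.

Lemma Cstar_ge0 V t : (0 <= Cstar V t)%E.
Proof.
apply: limf_esup_ge0 => [|x]; first exact: filter_not_empty.
by rewrite lee_fin divr_ge0 ?tail_ge0.
Qed.

Lemma Cstar_lt_near V t (c : R) : tail_pos V -> (Cstar V t < c%:E)%E ->
  \forall x \near +oo, tail V (x - t) <= c * tail V x.
Proof.
move=> V0 /limf_esup_lt_near Vc.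
near=> x; rewrite -ler_pdivrMr; last by near: x.
by rewrite ltW// -lte_fin; near: x; exact: Vc.
Unshelve. all: end_near. Qed.

Lemma near_Cstar_le V t (c : R) : tail_pos V ->
  (\forall x \near +oo, tail V (x - t) <= c * tail V x) ->
  (Cstar V t <= c%:E)%E.
Proof.
move=> V0 Vc; apply: near_limf_esup_le.
near=> x; rewrite lee_fin ler_pdivrMr; last by near: x.
by near: x.
Unshelve. all: end_near. Qed.

Lemma OL_fin_num V t : OL V -> 0 < t -> Cstar V t \is a fin_num.
Proof. by move=> [_ VC] t0; rewrite ge0_fin_numE ?Cstar_ge0// VC. Qed.

(** * Convolution *)

Lemma convolveE V W (A : set T) :
  convolve V W A = (V \x W)%E (@addp R @^-1` A).
Proof. by []. Qed.

Lemma measurable_sum_gt s : measurable [set z : T * T | s < z.1 + z.2].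
Proof.
rewrite (_ : [set _ | _] = @addp R @^-1` `]s, +oo[%classic).
  by apply: measurable_funPTI.
by apply/seteqP; split=> z /=; rewrite in_itv/= andbT.
Qed.

Lemma tail_convolveE V W x :
  (tail (convolve V W) x)%:E = (V \x W)%E [set z | x < z.1 + z.2].
Proof.
rewrite tailE convolveE; congr ((V \x W)%E _).
by apply/seteqP; split=> z /=; rewrite in_itv/= andbT.
Qed.

Lemma product_measure_tails V W a b :
  (V \x W)%E [set z | a < z.1 /\ b < z.2] = (tail V a * tail W b)%:E.
Proof.
rewrite EFinM !tailE -product_measure1E//; congr ((V \x W)%E _).
by apply/seteqP; split=> z /=; rewrite !in_itv/= !andbT.
Qed.

Lemma supported_nonneg_itv_eq1 V :
  supported_nonneg V -> V `[0, +oo[%classic = 1%E.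
Proof.
by move=> V0; rewrite -setCitvl probability_setC//= [X in (_ - X)%E]V0 sube0.
Qed.

(** Adding an independent nonnegative variable can only enlarge the tail. *)
Lemma tail_convolve_ge V W x : supported_nonneg V ->
  tail W x <= tail (convolve V W) x.
Proof.
move=> /supported_nonneg_itv_eq1 V1; rewrite -lee_fin tail_convolveE.
rewrite [leLHS](_ : _ = (V \x W)%E (`[0, +oo[%classic `*` `]x, +oo[%classic)).
  rewrite le_measure ?inE//; first by apply: measurableX.
    exact: measurable_sum_gt.
  by move=> z /=; rewrite !in_itv/=; lra.
by rewrite product_measure1E// [X in (X * _)%E]V1 mul1e tailE.
Qed.

Lemma tail_pos_convolve V W : supported_nonneg V -> tail_pos W ->
  tail_pos (convolve V W).
Proof.
move=> V0 W0; near=> x; rewrite (lt_le_trans _ (tail_convolve_ge W x V0))//.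
by near: x.
Unshelve. all: end_near. Qed.

Lemma supported_nonneg_le V (A B : set T) : supported_nonneg V ->
  measurable A -> measurable B -> A `&` `[0, +oo[%classic `<=` B ->
  (V A <= V B)%E.
Proof.
move=> V0 mA mB AB.
rewrite -(@measureU0 _ _ _ V B `]-oo, 0[%classic)//.
rewrite le_measure ?inE//; first exact: measurableU.
move=> x Ax; case: (ltP x 0) => x0; [right|left; apply: AB; split=> //].
  by rewrite /= in_itv.
by rewrite /= in_itv/= x0.
Qed.

Lemma supported_nonneg_convolve V W :
  supported_nonneg V -> supported_nonneg W -> supported_nonneg (convolve V W).
Proof.
move=> V0 W0; rewrite /supported_nonneg convolveE.
have mN : measurable (`]-oo, 0[%classic : set T) by [].
apply/eqP; rewrite -measure_le0.
apply: (@le_trans _ _ ((V \x W)%E ((`]-oo, 0[%classic `*` setT) `|`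
  (setT `*` `]-oo, 0[%classic)))).
  rewrite le_measure ?inE//; first exact: (measurable_funPTI (@addp R)).
    by apply: measurableU; by apply: measurableX.
  move=> z /=; rewrite !in_itv/= /addp.
  case: (ltP z.1 0) => z1; first by left.
  by case: (ltP z.2 0) => z2; [right|lra].
rewrite (le_trans (measureU2 _ _ _))//; [by apply: measurableX..|].
rewrite /= !product_measure1E// [X in (X * _)%E]V0 mul0e add0e.
by rewrite [X in (_ * X)%E]W0 mule0.
Qed.

Lemma supported_nonneg_convolve_pow V k :
  supported_nonneg V -> supported_nonneg (convolve_pow V k).
Proof.
move=> V0; elim: k => [|k IH]; last exact: supported_nonneg_convolve.
rewrite /supported_nonneg/= diracE/= memNset//= in_itv/= ltxx//.
Qed.

(** The first power is the convolution of V with the unit mass at 0. *)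
Lemma tail_convolve_pow1 V : tail (convolve_pow V 1) = tail V.
Proof.
apply/funext => x; apply: EFin_inj.
rewrite tail_convolveE product_measure12E; last exact: measurable_sum_gt.
rewrite [LHS]integral_dirac//; last first.
  by apply: measurable_fun_ysection; exact: measurable_sum_gt.
rewrite diracT mul1e /= tailE ysectionE; congr (V _).
by apply/seteqP; split=> y; rewrite /= in_itv/= andbT addr0.
Qed.

(** * Splitting the tail of a convolution *)

Definition fst_le_sum_gt a s : set (T * T) := [set z | z.1 <= a /\ s < z.1 + z.2].
Definition snd_le_sum_gt a s : set (T * T) := [set z | z.2 <= a /\ s < z.1 + z.2].

Lemma measurable_fst_le_sum_gt a s : measurable (fst_le_sum_gt a s).
Proof.
rewrite (_ : fst_le_sum_gt a s =
    (fst @^-1` `]-oo, a]%classic) `&` [set z : T * T | s < z.1 + z.2]).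
  apply: measurableI; last exact: measurable_sum_gt.
  by rewrite -[X in measurable X]setTI; exact: measurable_fst.
by apply/seteqP; split=> z /=; rewrite in_itv.
Qed.

Lemma measurable_snd_le_sum_gt a s : measurable (snd_le_sum_gt a s).
Proof.
rewrite (_ : snd_le_sum_gt a s =
    (snd @^-1` `]-oo, a]%classic) `&` [set z : T * T | s < z.1 + z.2]).
  apply: measurableI; last exact: measurable_sum_gt.
  by rewrite -[X in measurable X]setTI; exact: measurable_snd.
by apply/seteqP; split=> z /=; rewrite in_itv.
Qed.

#[local] Hint Resolve measurable_fst_le_sum_gt measurable_snd_le_sum_gt : core.

(** For a fixed value u <= a of the first coordinate the two events are tails
    of W, at s - u and at r - u. *)
Lemma fst_le_sum_gt_le V W a s r m : 0 <= m ->
  (forall u, u <= a -> tail W (s - u) <= m * tail W (r - u)) ->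
  ((V \x W) (fst_le_sum_gt a s) <= m%:E * (V \x W) (fst_le_sum_gt a r))%E.
Proof.
move=> m0 Wm; apply: le_product_xsection => // u.
have [ua|au] := leP (u : R) a; last first.
  rewrite (_ : [set y | _] = set0) ?measure0 ?mule_ge0//.
  by apply/seteqP; split=> // y [] /=; rewrite leNgt au.
have secE q : [set y | fst_le_sum_gt a q (u, y)] = `]q - (u : R), +oo[%classic.
  apply/seteqP; split=> y; rewrite /fst_le_sum_gt /= in_itv/= andbT ltrBlDl//.
  by case.
rewrite !secE -[X in (X <= _)%E](tailE W) -[X in (_ * X)%E](tailE W).
by rewrite -EFinM lee_fin Wm.
Qed.

Lemma snd_le_sum_gt_le V W b s r m : 0 <= m ->
  (forall u, u <= b -> tail V (s - u) <= m * tail V (r - u)) ->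
  ((V \x W) (snd_le_sum_gt b s) <= m%:E * (V \x W) (snd_le_sum_gt b r))%E.
Proof.
move=> m0 Vm; apply: le_product_ysection => // u.
have [ub|bu] := leP (u : R) b; last first.
  rewrite (_ : [set y | _] = set0) ?measure0 ?mule_ge0//.
  by apply/seteqP; split=> // y [] /=; rewrite leNgt bu.
have secE q : [set y | snd_le_sum_gt b q (y, u)] = `]q - (u : R), +oo[%classic.
  apply/seteqP; split=> y; rewrite /snd_le_sum_gt /= in_itv/= andbT ltrBlDr//.
  by case.
rewrite !secE -[X in (X <= _)%E](tailE V) -[X in (_ * X)%E](tailE V).
by rewrite -EFinM lee_fin Vm.
Qed.

Lemma measurable_tails a b : measurable [set z : T * T | a < z.1 /\ b < z.2].
Proof.
rewrite (_ : [set _ | _] = `]a, +oo[%classic `*` `]b, +oo[%classic).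
  exact: measurableX.
by apply/seteqP; split=> z /=; rewrite !in_itv/= !andbT.
Qed.

Lemma tail_convolve_le_split V W a b s :
  ((tail (convolve V W) s)%:E <= (V \x W) (fst_le_sum_gt a s) +
    (V \x W) (snd_le_sum_gt b s) + (tail V a * tail W b)%:E)%E.
Proof.
rewrite tail_convolveE -product_measure_tails.
have mL := measurable_tails a b.
apply: (@le_trans _ _ ((V \x W)%E ((fst_le_sum_gt a s `|` snd_le_sum_gt b s)
    `|` [set z | a < z.1 /\ b < z.2]))).
  rewrite le_measure ?inE//; first exact: measurable_sum_gt.
    by apply: measurableU => //; exact: measurableU.
  move=> z sz /=; case: (leP z.1 a) => za; first by left; left.
  by case: (leP z.2 b) => zb; [left; right|right].
rewrite (le_trans (measureU2 _ _ _))//; first exact: measurableU.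
by rewrite leeD2r// measureU2.
Qed.

(** Lowering the level of V * W by t gains the factor 1 / m, except on the
    rectangle where both coordinates are large, whose probability is the last
    term. On the rest, one coordinate is small and the other is compared with its
    own tail at a level that is at least x - a for W and a + t for V. *)
Lemma convolve_tail_split V W a m x t : 0 <= t -> 0 <= m ->
  (forall y, a + t <= y -> tail V y <= m * tail V (y - t)) ->
  (forall y, x - a <= y -> tail W y <= m * tail W (y - t)) ->
  tail (convolve V W) x <=
    m * tail (convolve V W) (x - t) + tail V a * tail W (x - a - t).
Proof.
move=> t0 m0 Vm Wm; pose b := x - a - t.
have Wle : ((V \x W) (fst_le_sum_gt a x) <=
            m%:E * (V \x W) (fst_le_sum_gt a (x - t)%R))%E.
  by apply: fst_le_sum_gt_le => // u ua; rewrite addrAC Wm// lerB.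
have Vle : ((V \x W) (snd_le_sum_gt b x) <=
            m%:E * (V \x W) (snd_le_sum_gt b (x - t)%R))%E.
  by apply: snd_le_sum_gt_le => // u; rewrite /b => ub; rewrite addrAC Vm//; lra.
(* The thresholds add up to x - t, hence the two shifted events are disjoint. *)
have disj : ((V \x W) (fst_le_sum_gt a (x - t)%R) +
    (V \x W) (snd_le_sum_gt b (x - t)%R) <=
    (tail (convolve V W) (x - t))%:E)%E.
  rewrite tail_convolveE -measureU//; last first.
    apply/seteqP; split=> // z [[za sz] [zb _]].
    by move: za zb sz; rewrite /b/=; lra.
  rewrite le_measure ?inE//; first exact: measurableU.
    exact: measurable_sum_gt.
  by move=> z [[]|[]].
rewrite -lee_fin (le_trans (tail_convolve_le_split _ _ a b _))//.
rewrite EFinD leeD2r// (le_trans (leeD Wle Vle))// EFinM.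
by rewrite -ge0_muleDr// lee_wpmul2l.
Qed.

(** Write the second coordinate as Y + Z with Y ~ V and Z ~ M. As Z >= 0, the
    event on the left forces Y <= b, and exchanging the independent, identically
    distributed first coordinate and Y turns this constraint into the one on the
    right. The exchange is an application of Fubini's theorem. *)
Lemma product_convolve_swap_le V M b s : supported_nonneg M ->
  ((V \x convolve V M) (snd_le_sum_gt b s) <=
   (V \x convolve V M) (fst_le_sum_gt b s))%E.
Proof.
move=> M0.
pose D := [set w : (T * T) * T | w.1.1 <= b /\ s < w.1.1 + w.1.2 + w.2].
pose g := M \o xsection D.
have mD : measurable D.
  have m11 : measurable_fun setT (fun w : (T * T) * T => w.1.1 : R).
    by apply: (measurableT_comp (f := fst)); exact: measurable_fst.
  have m12 : measurable_fun setT (fun w : (T * T) * T => w.1.2 : R).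
    apply: (measurableT_comp (f := snd)); first exact: measurable_snd.
    exact: measurable_fst.
  have m2 : measurable_fun setT (fun w : (T * T) * T => w.2 : R).
    exact: measurable_snd.
  have m3 : measurable_fun setT
      (fun w : (T * T) * T => w.1.1 + w.1.2 + w.2 : R).
    by do 2 apply: measurable_realfun.measurable_funD => //.
  rewrite (_ : D =
    ((fun w : (T * T) * T => w.1.1 : R) @^-1` `]-oo, b]%classic) `&`
    ((fun w : (T * T) * T => w.1.1 + w.1.2 + w.2 : R) @^-1` `]s, +oo[%classic)).
    apply: measurableI.
      by rewrite -[X in measurable X]setTI; exact: m11.
    by rewrite -[X in measurable X]setTI; exact: m3.
  by apply/seteqP; split=> z /=; rewrite !in_itv/= andbT.
have mg := measurable_fun_xsection M mD.
have convE (A : set (T * T)) x :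
    convolve V M (xsection A x) =
    (\int[V]_y M (xsection (@addp R @^-1` xsection A x) y))%E.
  by rewrite convolveE.
have mconv (A : set (T * T)) x : measurable A ->
    measurable (@addp R @^-1` xsection A x).
  by move=> mA; apply: (measurable_funPTI (@addp R)); exact: measurable_xsection.
rewrite [leRHS](_ : _ = \int[V]_x \int[V]_y g (x, y))%E; last first.
  apply: eq_integral => x _; rewrite [LHS]convE//; apply: eq_integral => y _.
  rewrite /g /= !xsectionE; congr (M _).
  by apply/seteqP; split=> u; rewrite /fst_le_sum_gt /addp /= addrA.
(* After the exchange, the constraint on g bears on the inner variable y. *)
rewrite fubini_tonelli; [|exact: mg|by move=> z; exact: measure_ge0].
apply: ge0_le_integral => //.
- exact: measurable_fun_xsection.
- by apply: measurable_fun_fubini_tonelli_G => // z; exact: measure_ge0.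
move=> x _; rewrite [leLHS]convE//.
apply: ge0_le_integral => //.
- by apply: measurable_fun_xsection; exact: mconv.
- rewrite (_ : (fun y => _) = M \o xsection (fst_le_sum_gt b (s - (x : R)))).
    by exact: measurable_fun_xsection.
  apply/funext => y; rewrite /g /= !xsectionE; congr (M _).
  by apply/seteqP; split=> u /= [] /= ? ?; split=> //=; lra.
move=> y _; rewrite /g /=; apply: supported_nonneg_le => //.
- by apply: measurable_xsection; exact: mconv.
- exact: measurable_xsection.
move=> u []; rewrite !xsectionE /snd_le_sum_gt /= in_itv/= andbT /addp /=.
move=> -[yu sxyu] u0; split=> /=; last by rewrite (addrC (y : R)) -addrA.
by rewrite (le_trans _ yu)// lerDl.
Qed.

(** Cutting both coordinates at b, half the level: the exchange bounds the event
    where the second coordinate is small by the one where the first is, which is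
    why the constant doubles. *)
Lemma convolve_tail_double V M b t m :
  supported_nonneg M -> 0 <= t -> 0 <= m ->
  (forall y, b <= y ->
     tail (convolve V M) y <= m * tail (convolve V M) (y + t)) ->
  tail (convolve V (convolve V M)) (b + b) <=
    2 * m * tail (convolve V (convolve V M)) (b + b + t).
Proof.
move=> M0 t0 m0; set W := convolve V M => Wm.
set G := tail (convolve V W).
have Wle : ((V \x W) (fst_le_sum_gt b (b + b)%R) <=
            m%:E * (V \x W) (fst_le_sum_gt b (b + b + t)%R))%E.
  apply: fst_le_sum_gt_le => // u ub.
  by rewrite (addrAC _ t) Wm// -addrA lerDl subr_ge0.
have Lle : ((tail V b * tail W b)%:E <=
            m%:E * (tail V b * tail W (b + t)%R)%:E)%E.
  by rewrite -EFinM lee_fin mulrCA ler_wpM2l ?tail_ge0// Wm.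
have disj : ((V \x W) (fst_le_sum_gt b (b + b + t)%R) +
    (tail V b * tail W (b + t))%:E <= (G (b + b + t))%:E)%E.
  have mL := measurable_tails b (b + t).
  rewrite tail_convolveE -product_measure_tails.
  rewrite -measureU; [|exact: measurable_fst_le_sum_gt|exact: mL|].
    rewrite le_measure ?inE; [by []|..|].
    - by apply: measurableU; [exact: measurable_fst_le_sum_gt|exact: mL].
    - exact: measurable_sum_gt.
    - by move=> z [[]|[bz tz]]; rewrite //= -addrA ltrD.
  apply/seteqP; split=> // z [[zb _] [bz _]].
  by move: bz; rewrite /= ltNge [z.1 <= b]zb.
have fst_le : ((V \x W) (fst_le_sum_gt b (b + b)%R) <= (m * G (b + b + t))%:E)%E.
  rewrite (le_trans Wle)// EFinM lee_wpmul2l// (le_trans _ disj)// leeDl//.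
  by rewrite lee_fin mulr_ge0 ?tail_ge0.
rewrite -lee_fin (le_trans (tail_convolve_le_split _ _ b b _))//.
rewrite -mulrA mulr_natl mulr2n EFinD addeAC.
apply: leeD; last exact: (le_trans (product_convolve_swap_le _ _ _ M0) fst_le).
apply: (le_trans (leeD Wle Lle)).
rewrite -ge0_muleDr ?measure_ge0 ?lee_fin ?mulr_ge0 ?tail_ge0//.
by rewrite [leRHS]EFinM lee_wpmul2l.
Qed.

(** * Closure under convolution *)

(** The rectangle term of [convolve_tail_split] is negligible: asymptotically
    tail W (x - a - t) <= C*(W, a) C*(W, t) tail W x. Submultiplicativity is used
    here so that tail V and C* are taken at the same point a, which the limit
    hypothesis requires: tail V a / tail V (a + t) may be unbounded. *)
Lemma tail_Cstar_small V W t (e : R) : OL W ->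
  ((tail V x)%:E * Cstar W x)%E @[x --> +oo] --> 0%E -> 0 < t -> 0 < e ->
  \forall a \near +oo, \forall x \near +oo,
    tail V a * tail W (x - a - t) <= e * tail W x.
Proof.
move=> WOL VW0 t0 e0; have W0 := WOL.1.
pose K := fine (Cstar W t) + 1.
have Kgt0 : 0 < K by rewrite ltr_wpDl// fine_ge0// Cstar_ge0.
(* With d as below, (tail V a * (C*(W, a) + d)) * K <= (d + d) * K = e. *)
pose d := e / (2 * K).
have d0 : 0 < d by rewrite divr_gt0// mulr_gt0.
have WK : \forall x \near +oo, tail W (x - t) <= K * tail W x.
  apply: Cstar_lt_near => //.
  by rewrite EFinD fineK ?OL_fin_num// lteDl ?OL_fin_num// lte_fin.
have small : \forall a \near +oo, ((tail V a)%:E * Cstar W a < d%:E)%E.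
  apply: (VW0 [set y | (y < d%:E)%E]).
  exact: (@nbhs_open_ereal_lt _ 0 (fun=> d)).
near=> a.
have a0 : 0 < a by near: a; apply: nbhs_pinfty_gt; rewrite num_real.
have Va : tail V a * fine (Cstar W a) < d.
  by rewrite -lte_fin EFinM fineK ?OL_fin_num//; near: a; exact: small.
have [M [_ Wa]] : \forall x \near +oo,
    tail W (x - a) <= (fine (Cstar W a) + d) * tail W x.
  apply: Cstar_lt_near => //.
  by rewrite EFinD fineK ?OL_fin_num// lteDl ?OL_fin_num// lte_fin.
near=> x.
have Mx : M < x - t.
  by rewrite ltrBrDr; near: x; apply: nbhs_pinfty_gt; rewrite num_real.
have Kx : tail W (x - t) <= K * tail W x by near: x; exact: WK.
rewrite (_ : x - a - t = x - t - a); last by rewrite addrAC.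
rewrite (le_trans (ler_wpM2l (tail_ge0 V a) (Wa _ Mx)))//.
rewrite mulrA (_ : e = (d + d) * K); last by rewrite /d; field; rewrite lt0r_neq0.
rewrite -[leRHS]mulrA ler_pM// ?tail_ge0//.
  by rewrite mulr_ge0 ?tail_ge0// addr_ge0// ?fine_ge0 ?Cstar_ge0 ?(ltW d0).
rewrite mulrDr; apply: lerD; first exact: ltW Va.
by rewrite ler_piMl ?tail_le1 ?(ltW d0).
Unshelve. all: end_near. Qed.

(** Pick a so large that the lower bound for V holds beyond a and the
    rectangle costs at most the fraction e of tail W x, then let x grow. *)
Lemma liminf_ratio_ge_convolve gamma V W :
  supported_nonneg V ->
  liminf_ratio_ge gamma V -> liminf_ratio_ge gamma W -> OL W ->
  ((tail V x)%:E * Cstar W x)%E @[x --> +oo] --> 0%E ->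
  liminf_ratio_ge gamma (convolve V W).
Proof.
move=> V0 /liminf_ratio_geP[_ Vg] /liminf_ratio_geP[_ Wg] WOL VW0.
apply/liminf_ratio_geP; split; first exact: tail_pos_convolve WOL.1.
move=> t c t0 ct.
have [c0|c0] := leP c 0.
  apply: nearW => x.
  by rewrite (le_trans _ (tail_ge0 _ _))// mulr_le0_ge0// tail_ge0.
(* The room between c and e^(gamma t) is spent in two steps: c' serves for the
   two factors, and e is what remains for the rectangle, as c' * (1 - e) = c. *)
pose c' := (c + expR (gamma * t)) / 2.
have cc' : c < c' by rewrite /c'; lra.
have c'0 : 0 < c' := lt_trans c0 cc'.
have c't : c' < expR (gamma * t) by rewrite /c'; lra.
have [A [_ VA]] := Vg _ _ t0 c't; have [B [_ WB]] := Wg _ _ t0 c't.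
pose e := 1 - c / c'.
have e0 : 0 < e by rewrite subr_gt0 ltr_pdivrMr// mul1r.
have [a [Aa [N [_ WN]]]] : exists a, A < a /\ \forall x \near +oo,
    tail V a * tail W (x - a - t) <= e * tail W x.
  near (pinfty_nbhs R) => a; exists a; split.
    by near: a; apply: nbhs_pinfty_gt; rewrite num_real.
  by near: a; exact: tail_Cstar_small.
near=> x.
have Nx : N < x by near: x; apply: nbhs_pinfty_gt; rewrite num_real.
have Bx : B < x - a.
  by rewrite ltrBrDr; near: x; apply: nbhs_pinfty_gt; rewrite num_real.
have := @convolve_tail_split V W a c'^-1 x t (ltW t0).
rewrite invr_ge0 (ltW c'0) => /(_ isT).
have Vc y : a + t <= y -> tail V y <= c'^-1 * tail V (y - t).
  by move=> ay; rewrite ler_pdivlMl// VA//; lra.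
have Wc y : x - a <= y -> tail W y <= c'^-1 * tail W (y - t).
  by move=> ay; rewrite ler_pdivlMl// WB// (lt_le_trans Bx).
move=> /(_ Vc Wc) split_le.
have : tail (convolve V W) x <=
    c'^-1 * tail (convolve V W) (x - t) + e * tail (convolve V W) x.
  rewrite (le_trans split_le)// lerD2l (le_trans (WN _ Nx))//.
  by rewrite ler_wpM2l ?(ltW e0)// tail_convolve_ge.
rewrite -lerBlDr -{1}[tail _ x]mul1r -mulrBl /e opprB addrCA subrr addr0.
by rewrite mulrAC mulrC ler_pM2l ?invr_gt0.
Unshelve. all: end_near. Qed.

(** Apply [convolve_tail_double] with b = (x - t) / 2, so that the levels compared
    are x - t and x; b tends to infinity with x, as the ratio bound requires. *)
Lemma Cstar_convolve_le V M t : supported_nonneg V -> supported_nonneg M ->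
  OL (convolve V M) -> 0 < t ->
  (Cstar (convolve V (convolve V M)) t <= 2%:E * Cstar (convolve V M) t)%E.
Proof.
move=> V0 M0; set W := convolve V M => WOL t0.
apply/lee_addgt0Pr => e e0.
have Cfin := OL_fin_num WOL t0.
have e20 : 0 < e / 2 by rewrite divr_gt0.
pose m := fine (Cstar W t) + e / 2.
have m0 : 0 <= m by rewrite addr_ge0 ?(ltW e20)// fine_ge0 ?Cstar_ge0.
have [B [_ WB]] : \forall x \near +oo, tail W (x - t) <= m * tail W x.
  apply: Cstar_lt_near; first exact: WOL.1.
  by rewrite /m EFinD fineK// lteDl// lte_fin.
rewrite -(fineK Cfin) -EFinM -EFinD.
rewrite (_ : 2 * _ + e = 2 * m); last by rewrite /m; field.
apply: near_Cstar_le; first exact: tail_pos_convolve WOL.1.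
near=> x.
have Bx : 2 * `|B| + t < x by near: x; apply: nbhs_pinfty_gt; rewrite num_real.
have := @convolve_tail_double V M ((x - t) / 2) t m M0 (ltW t0) m0.
rewrite -splitr subrK; apply=> y xy.
rewrite -{1}(addrK t y) WB//.
have := ler_norm B; have := normr_ge0 B; lra.
Unshelve. all: end_near. Qed.

Lemma OL_convolve V M : supported_nonneg V -> supported_nonneg M ->
  OL (convolve V M) -> OL (convolve V (convolve V M)).
Proof.
move=> V0 M0 WOL; split; first exact: tail_pos_convolve WOL.1.
move=> t t0; rewrite (le_lt_trans (Cstar_convolve_le V0 M0 WOL t0))//.
by rewrite -(fineK (OL_fin_num WOL t0)) -EFinM ltry.
Qed.

Lemma tail_Cstar_convolve_cvg0 U V M : supported_nonneg V -> supported_nonneg M ->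
  OL (convolve V M) ->
  ((tail U x)%:E * Cstar (convolve V M) x)%E @[x --> +oo] --> 0%E ->
  ((tail U x)%:E * Cstar (convolve V (convolve V M)) x)%E @[x --> +oo] --> 0%E.
Proof.
move=> V0 M0 WOL U0.
apply: (@squeeze_cvge _ _ _ _ (cst 0%E) _
  (fun x => 2%:E * ((tail U x)%:E * Cstar (convolve V M) x))%E).
- near=> x; rewrite /= mule_ge0 ?Cstar_ge0 ?lee_fin ?tail_ge0//=.
  rewrite muleCA lee_wpmul2l ?lee_fin ?tail_ge0// Cstar_convolve_le//.
- exact: cvg_cst.
- by rewrite -[X in _ --> X](mule0 2%:E); exact: cvgeZl.
Unshelve. all: end_near. Qed.

(** The induction must carry the membership in OL and the limit condition along
    with the conclusion. Since k0 >= 1, every power that occurs has the form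
    V * M, as the exchange argument demands. *)
Lemma liminf_ratio_ge_convolve_pow gamma V k0 : supported_nonneg V ->
  (1 <= k0)%N -> liminf_ratio_ge gamma V ->
  liminf_ratio_ge gamma (convolve_pow V k0) -> OL (convolve_pow V k0) ->
  ((tail V x)%:E * Cstar (convolve_pow V k0) x)%E @[x --> +oo] --> 0%E ->
  forall k : nat, (k0 <= k)%N -> liminf_ratio_ge gamma (convolve_pow V k).
Proof.
move=> V0 k01 Vg Vk0g Vk0OL Vk0C.
suff : forall k, (k0 <= k)%N -> [/\ liminf_ratio_ge gamma (convolve_pow V k),
    OL (convolve_pow V k) &
    ((tail V x)%:E * Cstar (convolve_pow V k) x)%E @[x --> +oo] --> 0%E].
  by move=> H k /H[].
elim=> [|k IH]; first by rewrite leqNgt (leq_trans _ k01).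
rewrite leq_eqVlt => /predU1P[<-//|]; rewrite ltnS => k0k.
have [Vkg VkOL VkC] := IH k0k.
case: k => [|k] in k0k Vkg VkOL VkC {IH} *.
  by move: (leq_trans k01 k0k).
have Mk := supported_nonneg_convolve_pow k V0.
split.
- exact: liminf_ratio_ge_convolve.
- exact: OL_convolve.
- exact: tail_Cstar_convolve_cvg0.
Qed.

End tails.

Theorem proposition6p1 (R : realType) (gamma : R) (gamma_ge0 : 0 <= gamma) :
  (* (i) *)
  (forall F1 F2 : distr R,
     supported_nonneg F1 -> supported_nonneg F2 ->
     liminf_ratio_ge gamma F1 -> liminf_ratio_ge gamma F2 ->
     OL F2 ->
     ((tail F1 x)%:E * Cstar F2 x)%E @[x --> +oo] --> 0%E ->
     liminf_ratio_ge gamma (convolve F1 F2)) /\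
  (* (ii) *)
  (forall (F : distr R) (k0 : nat),
     supported_nonneg F -> (1 <= k0)%N ->
     liminf_ratio_ge gamma F -> liminf_ratio_ge gamma (convolve_pow F k0) ->
     OL (convolve_pow F k0) ->
     ((tail F x)%:E * Cstar (convolve_pow F k0) x)%E @[x --> +oo] --> 0%E ->
     forall k : nat, (k0 <= k)%N -> liminf_ratio_ge gamma (convolve_pow F k)) /\
  (* (ii), the case k0 = 1 *)
  (forall F : distr R,
     supported_nonneg F ->
     liminf_ratio_ge gamma F ->
     OL F ->
     ((tail F x)%:E * Cstar F x)%E @[x --> +oo] --> 0%E ->
     forall k : nat, (1 <= k)%N -> liminf_ratio_ge gamma (convolve_pow F k)).
Proof.
split=> [F1 F2 F10 _ F1g F2g F2OL F0|].
  exact: liminf_ratio_ge_convolve.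
split=> [F k0 F0 k01 Fg Fk0g Fk0OL Fk0C|F F0 Fg FOL FC].
  exact: liminf_ratio_ge_convolve_pow.
apply: liminf_ratio_ge_convolve_pow => //;
  rewrite /liminf_ratio_ge /OL /Cstar /tail_pos /tail_ratio tail_convolve_pow1//.
Qed.
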